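(* Let $\Lambda=(\lambda_n)_{n\in\mathbb{N}^*}$ be a sequence of positive real numbers, ultimately strictly increasing and tending to $+\infty$, with $b(\Lambda)\in(0,+\infty)$. Assume that there exist a strictly positive number $\ell$ and another sequence $M=(\mu_n)_{n\in\mathbb{N}^*}$ of positive real numbers, ultimately strictly increasing and tending to $+\infty$, with $b(M)\in(0,+\infty)$, such that $$\sum_{k}\left|\frac{1}{\lambda_k}-\frac{1}{\ell\mu_k}\right|<+\infty.$$ Then $\ell$ is unique (i.e. for the given $\Lambda$ and $M$ there is only one $\ell>0$ for which this series converges); furthermore $$b(M)=\ell\, b(\Lambda).$$
   Context: $\mathbb{N}^*=\{1,2,3,\dots\}$. For a sequence $\Lambda=(\lambda_n)_{n\in\mathbb{N}^*}$ of positive real numbers, ultimately strictly increasing, with $\lambda_n\to+\infty$, the Beurling-Malliavin density $b(\Lambda)\in[0,+\infty]$ is the infimum of the numbers $a\ge 0$ for which there exists a sequence $(n_k)_{k\in\mathbb{N}^*}$ of distinct positive integers such that $\sum_{k=1}^\infty\left|\frac{1}{\lambda_k}-\frac{a}{n_k}\right|<\infty$; if no such $a$ exists, $b(\Lambda)=+\infty$. *)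

(* Defs.v *)
(* MathComp-Analysis; the real numbers are an arbitrary [R : realType]. *)
From mathcomp Require Import all_boot all_order all_algebra.
From mathcomp Require Import all_classical all_reals all_analysis.

Set Implicit Arguments.
Unset Strict Implicit.
Unset Printing Implicit Defensive.

Import Order.TTheory GRing.Theory Num.Theory.
Import numFieldNormedType.Exports.

Local Open Scope classical_set_scope.
Local Open Scope ring_scope.

(* A sequence (u_n) indexed by the positive integers is a function on [nat]
   whose value at 0 is irrelevant: conditions are only imposed, and sums only
   taken, over indices n >= 1. *)

Definition admissible (R : realType) (u : nat -> R) : Prop :=
  [/\ forall n, (0 < n)%N -> 0 < u n,
      \forall n \near \oo, u n < u n.+1
    & u n @[n --> \oo] --> +oo].

(* The series of nonnegative terms |x_k - y_k|, k >= 1, has a finite sum. *)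
Definition summable_dist (R : realType) (x y : nat -> R) : Prop :=
  (\sum_(1 <= k <oo) (`|x k - y k| : R)%:E < +oo)%E.

Definition distinct_positive (m : nat -> nat) : Prop :=
  (forall k, (0 < k)%N -> (0 < m k)%N) /\
  (forall j k, (0 < j)%N -> (0 < k)%N -> m j = m k -> j = k).

(* The Beurling-Malliavin density, in [0, +oo]; [ereal_inf set0] is [+oo]. *)
Definition BMdensity (R : realType) (u : nat -> R) : \bar R :=
  ereal_inf [set a%:E | a in [set a : R | 0 <= a /\
    exists m : nat -> nat, distinct_positive m /\
      summable_dist (fun k => (u k)^-1) (fun k => a / (m k)%:R)]].

(* Main.v *)
Require Import Defs.
From mathcomp Require Import all_boot all_order all_algebra.
From mathcomp Require Import all_classical all_reals all_analysis.

Set Implicit Arguments.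
Unset Strict Implicit.
Unset Printing Implicit Defensive.

Import Order.TTheory GRing.Theory Num.Theory.
Import numFieldNormedType.Exports.

Local Open Scope classical_set_scope.
Local Open Scope ring_scope.

(** Having a summable difference is an equivalence relation on sequences that
    is stable under multiplication by a constant. If [1/lam_k] and
    [1/(l mu_k)] are equivalent, then [1/lam_k] is equivalent to [a/n_k]
    exactly when [1/mu_k] is equivalent to [l a/n_k], with the same integers
    [n_k]. So the set of numbers whose infimum is [b(M)] is [l] times the one
    whose infimum is [b(Lambda)], whence [b(M) = l b(Lambda)]
    ([BMdensity_scale]). Since [b(Lambda)] is neither zero nor infinite, this
    formula determines [l], which gives uniqueness. *)

Lemma summable_dist_sym (R : realType) (x y : nat -> R) :
  summable_dist x y -> summable_dist y x.
Proof.
rewrite /summable_dist; congr (_ < _)%E.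
by apply: eq_eseriesr => k _; rewrite distrC.
Qed.

Lemma summable_dist_trans (R : realType) (x y z : nat -> R) :
  summable_dist x y -> summable_dist y z -> summable_dist x z.
Proof.
move=> xy yz; apply: le_lt_trans (lte_add_pinfty xy yz).
rewrite -nneseriesD; [|by move=> *; rewrite lee_fin..].
apply: lee_nneseries => [k _|k _]; first by rewrite lee_fin.
by rewrite -EFinD lee_fin ler_distD.
Qed.

Lemma summable_dist_scale (R : realType) (c : R) (x y : nat -> R) :
  summable_dist x y -> summable_dist (fun k => c * x k) (fun k => c * y k).
Proof.
move=> xy; rewrite /summable_dist.
under eq_eseriesr do rewrite -mulrBr normrM EFinM.
rewrite nneseriesZl; last by move=> *; rewrite lee_fin.
by apply: lte_mul_pinfty; rewrite ?lee_fin.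
Qed.

Lemma summable_dist_inv_scale (R : realType) (l : R) (u v : nat -> R) :
  0 < l -> summable_dist (fun k => (u k)^-1) (fun k => (l * v k)^-1) ->
  summable_dist (fun k => (v k)^-1) (fun k => (l^-1 * u k)^-1).
Proof.
move=> l0 /summable_dist_sym /(summable_dist_scale l).
congr summable_dist; apply/funext => k; rewrite invfM ?invrK //.
by rewrite mulVKf // gt_eqF.
Qed.

(** If [a] competes in the infimum defining the density of [u], then [l * a]
    competes, with the same integers, in the one defining the density of
    [v]. *)
Lemma BMdensity_le_scale (R : realType) (l : R) (u v : nat -> R) :
  0 < l -> summable_dist (fun k => (u k)^-1) (fun k => (l * v k)^-1) ->
  (BMdensity v <= l%:E * BMdensity u)%E.
Proof.
move=> l0 uv; rewrite -lee_pdivrMl //.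
apply: le_ereal_inf_tmp => _ [a] [a0 [m [dm um]]] <-.
rewrite lee_pdivrMl // -EFinM; apply: ereal_inf_lbound; exists (l * a) => //.
split; first by rewrite mulr_ge0 // ltW.
exists m; split => //.
have := summable_dist_scale l (summable_dist_trans (summable_dist_sym uv) um).
congr summable_dist; apply/funext => k; last by rewrite mulrA.
by rewrite invfM mulVKf // gt_eqF.
Qed.

(** The hypothesis is symmetric under exchanging [u] and [v] and inverting
    [l], so one inequality suffices. *)
Lemma BMdensity_scale (R : realType) (l : R) (u v : nat -> R) :
  0 < l -> summable_dist (fun k => (u k)^-1) (fun k => (l * v k)^-1) ->
  BMdensity v = (l%:E * BMdensity u)%E.
Proof.
move=> l0 uv; apply/eqP; rewrite eq_le BMdensity_le_scale //=.
rewrite -lee_pdivlMl //; apply: BMdensity_le_scale; first by rewrite invr_gt0.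
exact: summable_dist_inv_scale.
Qed.

Theorem theorem6p2 (R : realType) (lam mu : nat -> R) (l : R)
    (hlam : admissible lam)
    (hblam : (0 < BMdensity lam < +oo)%E)
    (hl : 0 < l)
    (hmu : admissible mu)
    (hbmu : (0 < BMdensity mu < +oo)%E)
    (hsum : summable_dist (fun k => (lam k)^-1) (fun k => (l * mu k)^-1)) :
  (forall l' : R, 0 < l' ->
     summable_dist (fun k => (lam k)^-1) (fun k => (l' * mu k)^-1) ->
     l' = l) /\
  BMdensity mu = (l%:E * BMdensity lam)%E.
Proof.
split; last exact: BMdensity_scale.
move=> l' l'0 hsum'; have := BMdensity_scale l'0 hsum'.
rewrite (BMdensity_scale hl hsum).
case: (BMdensity lam) hblam => [b| |] //=; last by rewrite ltxx andbF.
by rewrite lte_fin => /andP[b0 _] [] /(mulIf (lt0r_neq0 b0)).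
Qed.
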